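(* For any integer $K\ge1$, $$\frac{K+2^{-K}-1}{(K+1)(2K+2^{-K})}\le\sup_{\rho>0}\big(\nu_K(K)-\pi_K(K,K)\big)\le\frac1{K+1},$$ $$\frac{2^{-1}-2^{-K}}{(2K+2^{-1})(2K+2^{-K})}\le\sup_{\rho>0}\big(\pi_K(K,K)-\nu'(2K)\big)\le\frac{2}{K^2}.$$
   Context: For $\rho>0$ and $K\ge1$: $\nu_K$ is the geometric distribution with parameter $\rho$ on $\{0,\dots,K\}$, so $\nu_K(K)=\rho^K/\sum_{k=0}^K\rho^k$ (the blocking probability of an $M/M/1/K$ queue with arrival rate $\rho$ and service rate $1$). $\nu'$ is the stationary distribution of the $M/M/2/2K$ queue with arrival rate $2\rho$ and service rate $1$ per server: $\nu'(0)=\big(2\sum_{k=0}^{2K}\rho^k-1\big)^{-1}$, $\nu'(n)=2\nu'(0)\rho^n$ for $1\le n\le 2K$. All of $\nu_K$, $\nu'$, $\pi_K$ depend on $\rho$. $\pi_K$ is the invariant distribution of the symmetric finite-capacity JSQ model: two one-server queues, each of capacity $K$; service times are exponential with parameter $1$ at both queues; customers arrive according to a Poisson process with parameter $2\rho$ and join the shortest queue, or either queue with probability $1/2$ if both lengths are equal; when both queues have length $K$ arriving customers are lost. The queue-length process $(L_1(t),L_2(t))_{t\ge0}$ is the continuous-time Markov chain on $\{0,\dots,K\}^2$ with the following transition rates ($e_1,e_2$ the unit vectors). From $(k,k)$: to $(k,k)+e_1$ and to $(k,k)+e_2$ at rate $\rho$ each if $k<K$; to $(k,k)-e_1$ and to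 $(k,k)-e_2$ at rate $1$ each if $k>0$. From $(j,k)$ with $j<k$: to $(j+1,k)$ at rate $2\rho$, to $(j-1,k)$ at rate $1$ if $j>0$, to $(j,k-1)$ at rate $1$. From $(k,j)$ with $j<k$: to $(k,j+1)$ at rate $2\rho$, to $(k,j-1)$ at rate $1$ if $j>0$, to $(k-1,j)$ at rate $1$. The chain is irreducible, and $\pi_K$ denotes its unique invariant probability distribution. *)

(* Defs.v *)
From HB Require Import structures.
From mathcomp Require Import all_boot all_order all_algebra.
From mathcomp Require Import all_classical all_reals all_analysis.

Set Implicit Arguments.
Unset Strict Implicit.
Unset Printing Implicit Defensive.

Import Order.TTheory GRing.Theory Num.Theory.
Local Open Scope ring_scope.

Section FiniteChains.
Variables (R : realType) (S : finType).
Implicit Types (q : S -> S -> R) (p : S -> R).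

(* Only the off-diagonal values of the rate function [q] are used. *)
Definition generator q (x y : S) : R :=
  if x == y then - \sum_(z | z != x) q x z else q x y.

Definition probability_vector p : Prop :=
  (forall x, 0 <= p x) /\ \sum_x p x = 1.

Definition invariant_distribution q p : Prop :=
  probability_vector p /\ forall y, \sum_x p x * generator q x y = 0.

Lemma generator_row_sum q x : \sum_y generator q x y = 0.
Proof.
rewrite (bigD1 x) //= {1}/generator eqxx.
rewrite [X in _ + X](eq_bigr (q x)) ?addNr // => y yx.
by rewrite /generator eq_sym (negPf yx).
Qed.

Lemma generator_offdiag_ge0 q x y :
  (forall x y, 0 <= q x y) -> x != y -> 0 <= generator q x y.
Proof. by move=> q0 xy; rewrite /generator (negPf xy). Qed.

Lemma generator_diag_le0 q x :
  (forall x y, 0 <= q x y) -> generator q x x <= 0.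
Proof. by move=> q0; rewrite /generator eqxx oppr_le0 sumr_ge0. Qed.

Lemma invariant_distribution_exists q : (0 < #|S|)%N ->
  (forall x y, 0 <= q x y) -> exists p, invariant_distribution q p.
Proof.
move=> S0 q0.
pose A := \matrix_(i < #|S|, j < #|S|) generator q (enum_val i) (enum_val j).
have A1 : A *m (const_mx 1 : 'cV_#|S|) = 0.
  apply/matrixP => i j; rewrite !mxE.
  under eq_bigr do rewrite !mxE mulr1.
  by rewrite -(big_enum_val (fun y => generator q (enum_val i) y))
             /= generator_row_sum.
have detA : \det A == 0.
  apply: contraT => dA.
  have uA : A \in unitmx by rewrite unitmxE unitfE.
  have := mulKmx uA (const_mx 1 : 'cV_#|S|).
  rewrite A1 mulmx0 => /matrixP/(_ (Ordinal S0) ord0).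
  by rewrite !mxE => /eqP; rewrite eq_sym oner_eq0.
have /det0P [v v0 vA] := detA.
pose w x := v ord0 (enum_rank x).
have wQ y : \sum_x w x * generator q x y = 0.
  have /matrixP/(_ ord0 (enum_rank y)) := vA; rewrite !mxE => vAy.
  rewrite -[RHS]vAy (reindex (fun i : 'I_#|S| => enum_val i)) /=; last first.
    by exists enum_rank => i _; rewrite ?enum_valK ?enum_rankK.
  by apply: eq_bigr => i _; rewrite /w enum_valK !mxE enum_rankK.
have wQ_ge0 y : 0 <= \sum_x `|w x| * generator q x y.
  rewrite (bigD1 y) //= -lerBlDl sub0r -mulrN.
  have -> : - generator q y y = `|generator q y y|.
    by rewrite ler0_norm ?generator_diag_le0.
  rewrite -normrM.
  have -> : w y * generator q y y = - \sum_(x | x != y) w x * generator q x y.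
    by apply/eqP; rewrite -addr_eq0; have /eqP := wQ y; rewrite (bigD1 y).
  rewrite normrN (le_trans (ler_norm_sum _ _ _))// ler_sum// => x xy.
  by rewrite normrM (ger0_norm (generator_offdiag_ge0 q0 xy)).
have wQ_eq0 y : \sum_x `|w x| * generator q x y = 0.
  have : \sum_y \sum_x `|w x| * generator q x y = 0.
    rewrite exchange_big big1 //= => x _.
    by rewrite -mulr_sumr generator_row_sum mulr0.
  by move=> /(psumr_eq0P (fun y _ => wQ_ge0 y)); apply.
pose m := \sum_x `|w x|.
have m0 : m != 0.
  apply: contra v0 => /eqP /(psumr_eq0P (fun x _ => normr_ge0 (w x))) w0.
  apply/eqP/matrixP => i j; rewrite mxE (ord1 i).
  by have /eqP := w0 (enum_val j) isT; rewrite normr_eq0 /w enum_valK => /eqP.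
exists (fun x => `|w x| / m); split; first split.
- by move=> x; rewrite divr_ge0// sumr_ge0.
- by rewrite -mulr_suml divff.
- move=> y; rewrite (eq_bigr (fun x => m^-1 * (`|w x| * generator q x y))).
    by rewrite -mulr_sumr wQ_eq0 mulr0.
  by move=> x _; rewrite mulrAC mulrC.
Qed.

Lemma detailed_balance_invariant q p : probability_vector p ->
  (forall x y, p x * q x y = p y * q y x) -> invariant_distribution q p.
Proof.
move=> pp db; split=> // y.
transitivity (\sum_x p y * generator q y x); last first.
  by rewrite -mulr_sumr generator_row_sum mulr0.
apply: eq_bigr => x _; rewrite /generator [y == x]eq_sym.
by case: eqP => [->|_].
Qed.

End FiniteChains.

Section Queues.
Variable R : realType.
Implicit Types (K N c : nat) (rho lambda : R).
Unset Implicit Arguments.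

(* Queue-length process of the M/M/c/N queue, with arrival rate [lambda] and
   service rate 1 at each of the [c] servers. *)
Definition mm_rate c N lambda (x y : 'I_N.+1) : R :=
  if y == x.+1 :> nat then lambda
  else if x == y.+1 :> nat then (minn x c)%:R
  else 0.

Definition nu K rho (n : 'I_K.+1) : R :=
  rho ^+ n / \sum_(k < K.+1) rho ^+ k.

Definition nu' K rho (n : 'I_(2 * K).+1) : R :=
  let nu'0 := (2 * (\sum_(k < (2 * K).+1) rho ^+ k) - 1)^-1 in
  if n == 0%N :> nat then nu'0 else 2 * nu'0 * rho ^+ n.

(* The state is the pair of queue lengths.  The capacity and the nonemptiness
   conditions of the transitions are enforced by the target lying in the state
   space. *)
Definition jsq_rate K rho (x y : 'I_K.+1 * 'I_K.+1) : R :=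
  let join (own other : 'I_K.+1) : R :=
    if (own < other)%N then 2 * rho else if own == other then rho else 0 in
  if (y.1 == x.1.+1 :> nat) && (y.2 == x.2) then join x.1 x.2
  else if (y.1 == x.1) && (y.2 == x.2.+1 :> nat) then join x.2 x.1
  else if (x.1 == y.1.+1 :> nat) && (y.2 == x.2) then 1
  else if (y.1 == x.1) && (x.2 == y.2.+1 :> nat) then 1
  else 0.

Lemma jsq_invariant_exists K rho : 0 < rho ->
  exists p, invariant_distribution (jsq_rate K rho) p.
Proof.
move=> rho0; apply: invariant_distribution_exists.
  by rewrite card_prod card_ord.
move=> x y; rewrite /jsq_rate.
by do !case: ifP => // _; rewrite ?ltW ?mulr_gt0.
Qed.

Lemma nu_invariant K rho : 0 < rho ->
  invariant_distribution (mm_rate 1 K rho) (nu K rho).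
Proof.
move=> rho0.
have s0 : 0 < \sum_(k < K.+1) rho ^+ k.
  by rewrite big_ord_recl ltr_pwDl ?expr0 // sumr_ge0 // => i _; rewrite exprn_ge0 ?ltW.
apply: detailed_balance_invariant.
  split; first by move=> x; rewrite divr_ge0 ?exprn_ge0 ?ltW.
  by rewrite -mulr_suml divff ?gt_eqF.
suff up (x y : 'I_K.+1) : y = x.+1 :> nat ->
    nu K rho x * mm_rate 1 K rho x y = nu K rho y * mm_rate 1 K rho y x.
  move=> x y; case: (eqVneq (y : nat) x.+1) => [/up//|xy].
  case: (eqVneq (x : nat) y.+1) => [/up//|yx].
  by rewrite /mm_rate (negPf xy) (negPf yx) !mulr0.
move=> yx; rewrite /mm_rate /nu yx eqxx.
rewrite ifF; last by apply/negbTE; rewrite neq_ltn ltnS leqnSn.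
by rewrite minnSS minn0 mulr1 mulrAC -exprSr.
Qed.

Lemma nu'_invariant K rho : 0 < rho ->
  invariant_distribution (mm_rate 2 (2 * K) (2 * rho)) (nu' K rho).
Proof.
move=> rho0.
have tail0 : 0 <= \sum_(i < 2 * K) rho ^+ (lift ord0 i : 'I_(2 * K).+1).
  by rewrite sumr_ge0 // => i _; rewrite exprn_ge0 ?ltW.
have dE : 2 * (\sum_(k < (2 * K).+1) rho ^+ k) - 1
    = 1 + 2 * \sum_(i < 2 * K) rho ^+ (lift ord0 i : 'I_(2 * K).+1).
  by rewrite big_ord_recl expr0 mulrDr mulr1 addrAC -[X in X - 1 + _]/(1 + 1) addrK.
have d0 : 0 < 2 * (\sum_(k < (2 * K).+1) rho ^+ k) - 1.
  by rewrite dE ltr_pwDl // mulr_ge0.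
apply: detailed_balance_invariant.
  split=> [x|].
    rewrite /nu'; case: ifP => _; first by rewrite invr_ge0 ltW.
    by rewrite !mulr_ge0 ?invr_ge0 ?exprn_ge0 ?ltW.
  rewrite big_ord_recl /nu' /=.
  rewrite -mulr_sumr -[X in X + _]mul1r [2 * _^-1]mulrC -mulrA.
  by rewrite mul1r -[X in X + _]mulr1 -mulrDr -dE mulVf ?gt_eqF.
suff up (x y : 'I_(2 * K).+1) : y = x.+1 :> nat ->
    nu' K rho x * mm_rate 2 (2 * K) (2 * rho) x y
    = nu' K rho y * mm_rate 2 (2 * K) (2 * rho) y x.
  move=> x y; case: (eqVneq (y : nat) x.+1) => [/up//|xy].
  case: (eqVneq (x : nat) y.+1) => [/up//|yx].
  by rewrite /mm_rate (negPf xy) (negPf yx) !mulr0.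
move=> yx; rewrite /mm_rate /nu' yx eqxx.
rewrite (ltn_eqF (leqnSn x.+1 : (x < x.+2)%N)) /=.
set d := (X in X^-1); case: (posnP x) => [->|x0].
  by rewrite expr1 mulr1 mulrCA mulrA.
rewrite minnSS (minn_idPr x0) exprSr -!mulrA.
by congr (_ * (_ * (_ * _))); rewrite mulrC.
Qed.

End Queues.

Arguments mm_rate {R} c N lambda x y.
Arguments nu {R} K rho n.
Arguments nu' {R} K rho n.
Arguments jsq_rate {R} K rho x y.

(* Main.v *)
(* Write [r] for [rho] and [B] for pi_K(K,K).  Pairing the invariance equations
   with a function [h(min(L1,L2), max(L1,L2))] on which the generator of the
   uncapacitated model is a constant [a] leaves only the blocked arrivals at
   [(K,K)]: [a = 2 r (h(K,K+1) - h(K,K)) B].  A suitable [h] combines the total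
   queue length, a function harmonic where both servers are busy, and
   correctors for the idle states; it yields
     [r^(2K) = B (\sum_(k <= 2K) r^k - 1/2 \sum_(i < K) (r/2)^i)].
   Both lower bounds are the values at [r = 1].  For the first upper bound, [B]
   is at least the blocking probability of the M/M/1/2K queue, and
   [nu_K(K) <= 1/(K+1)] for [r <= 1].  For the second, the difference of the
   inverse probabilities is [1/2 r^(-2K) \sum_(1 <= i < K) (r/2)^i], and
   [K^2 r^(2K+i) <= (\sum_(k <= 2K) r^k)^2] by the AM-GM inequality. *)

Require Import Defs.
From mathcomp Require Import all_boot all_order all_algebra.
From mathcomp Require Import all_classical all_reals all_analysis.
From mathcomp Require Import ring lra zify.
Import Order.TTheory GRing.Theory Num.Theory.
Local Open Scope classical_set_scope.
Local Open Scope ring_scope.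

(** * Invariance paired with functions of the queue lengths *)

(** Weight the invariance equation at [y] by [f y] and exchange the sums; the diagonal entry of the
    generator supplies the terms [- f x]. *)
Lemma invariant_dual (R : realType) (S : finType) (q : S -> S -> R)
    (p f : S -> R) :
  invariant_distribution q p ->
  \sum_x p x * \sum_y q x y * (f y - f x) = 0.
Proof.
move=> [_ pQ].
transitivity (\sum_y (\sum_x p x * generator q x y) * f y); last first.
  by rewrite big1 // => y _; rewrite pQ mul0r.
under [RHS]eq_bigr do rewrite mulr_suml.
rewrite exchange_big /=; apply: eq_bigr => x _.
under [RHS]eq_bigr do rewrite -mulrA.
rewrite -mulr_sumr; congr (_ * _).
rewrite (bigD1 x) //= [RHS](bigD1 x) //= subrr mulr0 add0r.
rewrite {1}/generator eqxx mulNr mulr_suml -sumrN -big_split /=.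
apply: eq_bigr => y yx.
by rewrite /generator eq_sym (negPf yx); ring.
Qed.

Lemma sum_at_pair (V : nmodType) n (a b : nat) (F : nat -> nat -> V) :
  \sum_(y : 'I_n.+1 * 'I_n.+1)
    F y.1 y.2 *+ ((y.1 == a :> nat) && (y.2 == b :> nat))
  = F a b *+ ((a <= n)%N && (b <= n)%N).
Proof.
case: (boolP (_ && _)) => [/andP[an bn]|abn].
  rewrite (bigD1 (Ordinal (an : (a < n.+1)%N), Ordinal (bn : (b < n.+1)%N))) //=.
  rewrite !eqxx big1 ?addr0 // => -[y1 y2] /=.
  by rewrite xpair_eqE -!val_eqE /= => /negPf ->.
rewrite big1 ?mulr0n // => -[y1 y2] _ /=.
case: eqP => [y1a|_] //; case: eqP => [y2b|_] //.
by move: abn; rewrite -y1a -y2b -!(ltnS _ n) !ltn_ord.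
Qed.

Lemma if_disjoint4 (V : nmodType) (b1 b2 b3 b4 : bool) (v1 v2 v3 v4 : V) :
  ~~ (b1 && b2) -> ~~ (b1 && b3) -> ~~ (b1 && b4) ->
  ~~ (b2 && b3) -> ~~ (b2 && b4) -> ~~ (b3 && b4) ->
  (if b1 then v1 else if b2 then v2 else if b3 then v3 else if b4 then v4 else 0)
  = v1 *+ b1 + v2 *+ b2 + v3 *+ b3 + v4 *+ b4.
Proof. by case: b1 b2 b3 b4 => [] [] [] []; rewrite ?mulr0n ?addr0 ?add0r. Qed.

Definition join_rate (R : realType) (rho : R) (own other : nat) : R :=
  if (own < other)%N then 2 * rho else if own == other then rho else 0.

Lemma jsq_rateE (R : realType) K (rho : R) (x y : 'I_K.+1 * 'I_K.+1) :
  jsq_rate K rho x y =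
    join_rate R rho x.1 x.2 *+ ((y.1 == x.1.+1 :> nat) && (y.2 == x.2 :> nat))
    + join_rate R rho x.2 x.1 *+ ((y.1 == x.1 :> nat) && (y.2 == x.2.+1 :> nat))
    + 1 *+ ((x.1 == y.1.+1 :> nat) && (y.2 == x.2 :> nat))
    + 1 *+ ((y.1 == x.1 :> nat) && (x.2 == y.2.+1 :> nat)).
Proof.
case: x y => [[x1 ?] [x2 ?]] [[y1 ?] [y2 ?]].
rewrite /jsq_rate -!val_eqE /=.
by apply: if_disjoint4; lia.
Qed.

(** At most four targets contribute. Writing them over [nat] lets [h] be evaluated past the
    capacity, which then shows only in the factors [x < K]. *)
Lemma jsq_expect_diff (R : realType) K (rho : R) (h : nat -> nat -> R)
    (x : 'I_K.+1 * 'I_K.+1) :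
  \sum_y jsq_rate K rho x y * (h y.1 y.2 - h x.1 x.2)
  = join_rate R rho x.1 x.2 * (h x.1.+1 x.2 - h x.1 x.2) *+ (x.1 < K)%N
    + join_rate R rho x.2 x.1 * (h x.1 x.2.+1 - h x.1 x.2) *+ (x.2 < K)%N
    + (h x.1.-1 x.2 - h x.1 x.2) + (h x.1 x.2.-1 - h x.1 x.2).
Proof.
under eq_bigr do rewrite jsq_rateE.
move: (join_rate _ _ x.1 x.2) (join_rate _ _ x.2 x.1) => c1 c2.
case: x => x1 x2 /=; pose F (c : R) (m n : nat) := c * (h m n - h x1 x2).
have x1K : (x1 <= K)%N by rewrite -(ltnS _ K).
have x2K : (x2 <= K)%N by rewrite -(ltnS _ K).
transitivity (\sum_(y : 'I_K.+1 * 'I_K.+1)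
  (F c1 y.1 y.2 *+ ((y.1 == x1.+1 :> nat) && (y.2 == x2 :> nat))
   + F c2 y.1 y.2 *+ ((y.1 == x1 :> nat) && (y.2 == x2.+1 :> nat))
   + F 1 y.1 y.2 *+ ((y.1 == x1.-1 :> nat) && (y.2 == x2 :> nat))
   + F 1 y.1 y.2 *+ ((y.1 == x1 :> nat) && (y.2 == x2.-1 :> nat)))).
  apply: eq_bigr => -[y1 y2] _; rewrite !mulrDl !mulrnAl /=.
  congr (_ + _ + _ + _).
    (* For [x1 = 0] the left indicator is false and the right one selects [y = x], where the
       increment is zero. *)
    rewrite {}/F; case: x1 {x1K} => -[|m] mK /=; last by rewrite eqSS eq_sym.
    have [y10|] //= := eqVneq (y1 : nat) 0%N.
    have [y2x2|] //= := eqVneq (y2 : nat) x2.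
    by rewrite y10 y2x2 subrr mulr0.
  rewrite {}/F; case: x2 {x2K} => -[|m] mK /=; last by rewrite eqSS [m == _]eq_sym.
  have [y1x1|] //= := eqVneq (y1 : nat) x1.
  have [y20|] //= := eqVneq (y2 : nat) 0%N.
  by rewrite y20 y1x1 subrr mulr0.
rewrite !big_split /= !sum_at_pair /F x1K x2K !(leq_trans (leq_pred _)) //.
by rewrite !andbT !mul1r.
Qed.

(* At an empty queue, [n.-1 = n] makes the departure term vanish, so that the
   boundary needs no separate equation. *)
Lemma jsq_blocking_test (R : realType) K (rho a : R) (h : nat -> nat -> R)
    (p : 'I_K.+1 * 'I_K.+1 -> R) :
  invariant_distribution (jsq_rate K rho) p ->
  (forall k, 2 * rho * (h k k.+1 - h k k) + 2 * (h k.-1 k - h k k) = a) ->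
  (forall j k, (j < k)%N ->
    2 * rho * (h j.+1 k - h j k) + (h j.-1 k - h j k) + (h j k.-1 - h j k) = a) ->
  a = 2 * rho * (h K K.+1 - h K K) * p (ord_max, ord_max).
Proof.
move=> pinv diag offdiag; have [[_ p1] _] := pinv.
(* Ordering the two lengths makes [f] symmetric, so a state and its mirror image satisfy the same
   equation in [h]. *)
pose f (m n : nat) := h (minn m n) (maxn m n).
have := invariant_dual _ _ _ _ (fun y : 'I_K.+1 * 'I_K.+1 => f y.1 y.2) pinv.
pose g := 2 * rho * (h K K.+1 - h K K).
(* Arrivals join a shorter queue, so the capacity binds only at [(K,K)]; [g] is the arrival term
   missing there. *)
rewrite (eq_bigr (fun x => a * p x - g * (if x == (ord_max, ord_max) then p x else 0))).
  rewrite big_split /= sumrN -!mulr_sumr p1 mulr1 -big_mkcond big_pred1_eq.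
  by move/eqP; rewrite subr_eq0 => /eqP.
move=> [x1 x2] _; rewrite (jsq_expect_diff _ _ rho f) /join_rate /=.
have x1K : (x1 <= K)%N by rewrite -(ltnS _ K).
have x2K : (x2 <= K)%N by rewrite -(ltnS _ K).
rewrite xpair_eqE -!val_eqE /= {}/f.
case: (ltngtP x1 x2) => x12.
- rewrite (leq_trans x12 x2K) (ltn_eqF (leq_trans x12 x2K)) /= mul0r mul0rn.
  rewrite -(offdiag _ _ x12).
  rewrite (minn_idPl x12) (maxn_idPr x12).
  have -> : minn x1.-1 x2 = x1.-1 by lia.
  have -> : maxn x1.-1 x2 = x2 by lia.
  have -> : minn x1 x2.-1 = x1 by lia.
  have -> : maxn x1 x2.-1 = x2.-1 by lia.
  by ring.
- rewrite (leq_trans x12 x1K) (ltn_eqF (leq_trans x12 x1K)) andbF /= mul0r mul0rn.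
  rewrite -(offdiag _ _ x12).
  rewrite (minn_idPr x12) (maxn_idPl x12).
  have -> : minn x1.-1 x2 = x2 by lia.
  have -> : maxn x1.-1 x2 = x1.-1 by lia.
  have -> : minn x1 x2.-1 = x2.-1 by lia.
  have -> : maxn x1 x2.-1 = x1 by lia.
  by ring.
- rewrite x12 andbb.
  have -> : minn x2.+1 x2 = x2 by lia.
  have -> : maxn x2.+1 x2 = x2.+1 by lia.
  have -> : minn x2 x2.+1 = x2 by lia.
  have -> : maxn x2 x2.+1 = x2.+1 by lia.
  have -> : minn x2.-1 x2 = x2.-1 by lia.
  have -> : maxn x2.-1 x2 = x2 by lia.
  have -> : minn x2 x2.-1 = x2.-1 by lia.
  have -> : maxn x2 x2.-1 = x2 by lia.
  rewrite -(diag x2); case: (ltngtP x2 K) x2K => // [x2K|->] _.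
    by rewrite !mulr1n; ring.
  by rewrite !mulr0n /g; ring.
Qed.

(** * Exact blocking probability of the JSQ model *)

(** This is [r^(2K) / pi_K(K,K)]. Unsummed geometric series keep it meaningful at [r = 1] and
    [r = 2]. *)
Definition blocking_denom (R : realType) (K : nat) (r : R) : R :=
  \sum_(k < (2 * K).+1) r ^+ k - 2^-1 * \sum_(i < K) (r / 2) ^+ i.

Lemma jsq_blocking_generic (R : realType) K (r : R)
    (p : 'I_K.+1 * 'I_K.+1 -> R) :
  0 < r -> r != 1 -> r != 2 -> invariant_distribution (jsq_rate K r) p ->
  r ^+ (2 * K) = p (ord_max, ord_max) * blocking_denom R K r.
Proof.
move=> r0 r1 r2 pinv; set B := p _.
(* The first summand is harmonic for [0 < j < k], with defect [2 (2 - r) (2 r)^(-k)] at [j = k > 0]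
   and [- r^(-k)] at [j = 0 < k]. The second cancels the diagonal defect and the fourth the boundary
   one. The third gives [a = 2 (2 - r) (1 - r)]; its own defect [-(2 - r)] at [j = 0 < k] is made up
   by the second. *)
pose h (j k : nat) : R := r^-1 ^+ k * 2^-1 ^+ j
  + (2 - r) * (\sum_(i < j) (2 * r)^-1 ^+ i.+1) - (2 - r) * (j + k)%:R
  + \sum_(i < j + k) r^-1 ^+ i.+1.
have rn0 : r != 0 by rewrite gt_eqF.
have hr j k : h j k.+1 - h j k =
    (r^-1 - 1) * (r^-1 ^+ k * 2^-1 ^+ j) - (2 - r) + r^-1 ^+ (j + k).+1.
  by rewrite /h addnS big_ord_recr /= [_%:R in LHS]mulrSr exprS; ring.
have hu j k : h j.+1 k - h j k =
    - 2^-1 * (r^-1 ^+ k * 2^-1 ^+ j) + (2 - r) * (2 * r)^-1 ^+ j.+1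
    - (2 - r) + r^-1 ^+ (j + k).+1.
  by rewrite /h addSn !big_ord_recr /= mulrSr [2^-1 ^+ j.+1]exprS; field.
clearbody h.
have E : 2 * (2 - r) * (1 - r) = 2 * r * (h K K.+1 - h K K) * B.
  apply: jsq_blocking_test pinv _ _.
    case=> [|k] /=; first by rewrite subrr hr !expr0 expr1; field.
    rewrite hr -(opprB (h k.+1 k.+1)) hu !(addSn, addnS).
    by rewrite invfM !exprMn !exprS !exprD; field.
  move=> [|j] [|k] // jk /=.
    by rewrite subrr hu -[h 0%N k - _]opprB hr !add0n invfM !expr0 expr1 !exprS; field.
  rewrite hu -[h j _ - _]opprB hu -[h j.+1 k - _]opprB hr !(addSn, addnS).
  by rewrite invfM !exprMn !exprS !exprD; field.
move: E; rewrite hr => E; rewrite /blocking_denom.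
have S1 := subrX1 r (2 * K).+1.
have S2 := subrX1 (r / 2) K.
set S := \sum_(k < (2 * K).+1) _ in S1 *; set T := \sum_(i < K) _ in S2 *.
have r1' : 1 - r != 0 by rewrite subr_eq0 eq_sym.
have r2' : 2 - r != 0 by rewrite subr_eq0 eq_sym.
(* This factor, nonzero here, puts both geometric sums in closed form. *)
apply: (mulfI (mulf_neq0 r2' r1')).
have -> : (2 - r) * (1 - r) * (B * (S - 2^-1 * T))
    = B * ((r - 2) * ((r - 1) * S) - (r - 1) * ((r / 2 - 1) * T)) by field.
rewrite -S1 -S2.
have XY : r ^+ K * r^-1 ^+ K = 1 by rewrite -exprMn divff ?expr1n.
rewrite exprMn exprS mul2n -addnn exprD.
have -> : (2 - r) * (1 - r) = 2^-1 * (2 * (2 - r) * (1 - r)) by field.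
rewrite E exprS exprD.
transitivity (B * (r * (r^-1 - 1) * (r ^+ K * r^-1 ^+ K) * r ^+ K * 2^-1 ^+ K
    - (2 - r) * r * (r ^+ K * r ^+ K) + (r ^+ K * r^-1 ^+ K) ^+ 2)).
  by field.
by rewrite XY; field.
Qed.

(* The test function of the generic case degenerates at [r = 1] and [r = 2]; those
   values are handled by its [r]-derivatives there, up to affine changes. *)
Lemma jsq_blocking_1 (R : realType) K (p : 'I_K.+1 * 'I_K.+1 -> R) :
  invariant_distribution (jsq_rate K 1) p ->
  1 = p (ord_max, ord_max) * (2 * K%:R + 2^-1 ^+ K).
Proof.
move=> pinv; set B := p _.
pose h (j k : nat) : R := (k%:R - j%:R - 3) * 2^-1 ^+ j
  + 2^-1 * (j + k)%:R * ((j + k)%:R - 1).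
have E : 2 = 2 * 1 * (h K K.+1 - h K K) * B.
  apply: jsq_blocking_test pinv _ _.
    case=> [|k] /=; rewrite /h.
      by rewrite addn1 addn0 !expr0; field.
    by rewrite !(addSn, addnS) -!natr1 !natrD exprS; field.
  move=> [|j] [|k] // jk; rewrite /h /=.
    by rewrite !add0n !add1n -!natr1 !expr0 expr1; field.
  by rewrite !(addSn, addnS) -!natr1 !natrD !exprS; field.
move: E; rewrite /h addnS -[K.+1%:R]natr1 -[(K + K).+1%:R]natr1 natrD => E.
apply: (mulfI (_ : 2 != 0 :> R)); first by [].
by rewrite mulr1 [LHS]E; field.
Qed.

Lemma jsq_blocking_2 (R : realType) K (p : 'I_K.+1 * 'I_K.+1 -> R) :
  invariant_distribution (jsq_rate K 2) p ->
  2 ^+ (2 * K) = p (ord_max, ord_max) * blocking_denom R K 2.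
Proof.
move=> pinv; set B := p _.
pose h (j k : nat) : R := (j + k)%:R + (j%:R + 2) * 2^-1 ^+ (j + k).+1
  + 3^-1 * (2^-1 ^+ j * 2^-1 ^+ j).
have E : 2 = 2 * 2 * (h K K.+1 - h K K) * B.
  apply: jsq_blocking_test pinv _ _.
    case=> [|k] /=; rewrite /h.
      by rewrite addn1 addn0 !expr0 !exprS !expr0; field.
    by rewrite !(addSn, addnS) -!natr1 !natrD !exprS !exprD; field.
  move=> [|j] [|k] // jk; rewrite /h /=.
    by rewrite !add0n !add1n -!natr1 !exprS expr0; field.
  by rewrite !(addSn, addnS) -!natr1 !natrD !exprS !exprD; field.
move: E; rewrite /h addnS -[(K + K).+1%:R]natr1 !exprS addnn -mul2n => E.
(* At [r = 2] the second geometric sum has ratio 1 and equals [K]. *)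
rewrite /blocking_denom divff; last by [].
have := subrX1 (2 : R) (2 * K).+1; set S := \sum_(k < _) _.
have -> : 2 - 1 = 1 :> R by ring.
rewrite mul1r => <-; under eq_bigr do rewrite expr1n.
rewrite sumr_const card_ord.
have rK : (2 : R) ^+ (2 * K) * 2^-1 ^+ (2 * K) = 1.
  by rewrite -exprMn divff ?expr1n.
apply: (mulfI (_ : 2 != 0 :> R)); first by [].
rewrite [X in X * _ = _]E exprS.
transitivity (B * (4 * 2 ^+ (2 * K)
    - (K%:R + 2) * (2 ^+ (2 * K) * 2^-1 ^+ (2 * K)))); first by field.
by rewrite rK; field.
Qed.

Lemma blocking_denom_at1 (R : realType) K :
  blocking_denom R K 1 = 2 * K%:R + 2 ^- K.
Proof.
rewrite /blocking_denom mul1r; under eq_bigr do rewrite expr1n.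
rewrite sumr_const card_ord -[(2 * K).+1%:R]natr1 natrM -exprVn.
have := subrX1 (2^-1 : R) K; set T := \sum_(i < K) _ => E.
by lra.
Qed.

Lemma jsq_blocking (R : realType) K (r : R) (p : 'I_K.+1 * 'I_K.+1 -> R) :
  0 < r -> invariant_distribution (jsq_rate K r) p ->
  r ^+ (2 * K) = p (ord_max, ord_max) * blocking_denom R K r.
Proof.
move=> r0 pinv; have [r1|r1] := eqVneq r 1.
  rewrite r1 in pinv *.
  by rewrite expr1n blocking_denom_at1 -exprVn -jsq_blocking_1.
have [r2|r2] := eqVneq r 2; last exact: jsq_blocking_generic.
by rewrite r2 in pinv *; exact: jsq_blocking_2.
Qed.

(** * Estimates for geometric sums *)

(** Termwise [(r/2)^i <= r^i], so the subtracted part is at most half of the full sum. The upper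
    bound is the comparison with the M/M/1/2K queue. *)
Lemma blocking_denom_bounds (R : realType) K (r : R) : 0 < r ->
  [/\ 0 < blocking_denom R K r,
      2^-1 * \sum_(k < (2 * K).+1) r ^+ k <= blocking_denom R K r
    & blocking_denom R K r <= \sum_(k < (2 * K).+1) r ^+ k].
Proof.
move=> r0; rewrite /blocking_denom; set A := \sum_(k < _) _.
have A0 : 0 < A.
  rewrite /A big_ord_recl expr0 ltr_pwDl // sumr_ge0 // => i _.
  by rewrite exprn_ge0 ?ltW.
have TA : \sum_(i < K) (r / 2) ^+ i <= A.
  rewrite /A -!(big_mkord predT (fun i => _ ^+ i)).
  rewrite (@big_cat_nat _ _ _ K 0 (2 * K).+1) //=; last by lia.
  rewrite -[X in X <= _]addr0 lerD // ?sumr_ge0 // => [|i _]; last first.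
    by rewrite exprn_ge0 ?ltW.
  rewrite ler_sum // => i _; rewrite lerXn2r ?nnegrE ?divr_ge0 ?ltW //.
  by rewrite gtr_pMr // invf_lt1 // ltr1n.
have T0 : 0 <= \sum_(i < K) (r / 2) ^+ i.
  by rewrite sumr_ge0 // => i _; rewrite exprn_ge0 ?divr_ge0 ?ltW.
by split; lra.
Qed.

(** Pair the exponents [i] and [n - i]: [s^(2i) + s^(2(n-i)) >= 2 s^n]. The ratio [s^2] avoids
    half-integer powers. *)
Lemma geometric_sum_AMGM (R : realDomainType) (s : R) n : 0 <= s ->
  n.+1%:R * s ^+ n <= \sum_(i < n.+1) (s ^+ 2) ^+ i.
Proof.
move=> s0; set S := \sum_(i < n.+1) _.
suff : n.+1%:R * s ^+ n *+ 2 <= S *+ 2 by rewrite lerMn2r.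
rewrite [X in _ <= X]mulr2n {2}/S (reindex_inj rev_ord_inj) /= -big_split /=.
rewrite -[n.+1 in X in X <= _]card_ord mulr_natl -mulrnA mulnC mulrnA.
rewrite -sumr_const ler_sum // => i _.
have -> : s ^+ n = s ^+ i * s ^+ (n - i) by rewrite -exprD subnKC // -ltnS.
rewrite subSS -!exprM ![(2 * _)%N]mulnC !exprM.
by have := sqr_ge0 (s ^+ i - s ^+ (n - i)); lra.
Qed.

(** With [s = sqrt r], take square roots and keep only the powers [r^i, ..., r^(2K)]: these are
    [2K - i + 1 >= K] terms with geometric mean [s^(2K+i)]. *)
Lemma geometric_sum_sqr_ge (R : realType) K i (r : R) : 0 < r -> (i <= K)%N ->
  K%:R ^+ 2 * r ^+ (2 * K + i) <= (\sum_(k < (2 * K).+1) r ^+ k) ^+ 2.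
Proof.
move=> r0 iK; set A := \sum_(k < _) _; pose s := Num.sqrt r.
have s0 : 0 <= s by rewrite sqrtr_ge0.
have -> : r = s ^+ 2 by rewrite sqr_sqrtr ?ltW.
rewrite -exprM mulnC exprM -exprMn.
rewrite lerXn2r ?nnegrE ?mulr_ge0 ?exprn_ge0 ?sumr_ge0 // => [k _|].
  by rewrite exprn_ge0 ?ltW.
have -> : (2 * K + i = 2 * i + (2 * K - i))%N by lia.
have H := geometric_sum_AMGM R s (2 * K - i) s0.
apply: (@le_trans _ _ (s ^+ (2 * i) * \sum_(l < (2 * K - i).+1) (s ^+ 2) ^+ l)).
  rewrite exprD mulrCA ler_wpM2l ?exprn_ge0 // (le_trans _ H) //.
  by rewrite ler_wpM2r ?exprn_ge0 // ler_nat; lia.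
rewrite mulr_sumr sqr_sqrtr ?(ltW r0) // exprM sqr_sqrtr ?(ltW r0) //.
rewrite /A -[X in _ <= X](big_mkord predT (fun k => r ^+ k)).
rewrite (@big_cat_nat _ _ _ i 0 (2 * K).+1) //=; last by lia.
rewrite -[X in X <= _]add0r lerD ?sumr_ge0 // => [k _|].
  by rewrite exprn_ge0 ?ltW.
rewrite -[X in \sum_(X <= _ < _) _]add0n big_addn subSn; last by lia.
by rewrite big_mkord ler_sum // => k _; rewrite -exprD addnC.
Qed.

(** * The two upper bounds for fixed [r] *)

Lemma nu_sub_le (R : realType) K (r : R) (p : 'I_K.+1 * 'I_K.+1 -> R) :
  0 < r -> invariant_distribution (jsq_rate K r) p ->
  nu K r ord_max - p (ord_max, ord_max) <= 1 / (K%:R + 1).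
Proof.
move=> r0 pinv; set B := p _.
have B0 : 0 <= B by case: pinv => -[p0 _] _; exact: p0.
rewrite /nu /=; set A := \sum_(k < _) _.
have A0 : 0 < A.
  rewrite /A big_ord_recl expr0 ltr_pwDl // sumr_ge0 // => i _.
  by rewrite exprn_ge0 ?ltW.
have K0 : 0 < K%:R + 1 :> R by rewrite natr1 ltr0n.
have [r1|r1] := leP r 1.
  rewrite (@le_trans _ _ (r ^+ K / A)) ?gerBl //.
  rewrite ler_pdivrMr // mulrAC ler_pdivlMr // mul1r natr1 mulr_natr.
  rewrite -[K.+1 in X in X <= _]card_ord -sumr_const ler_sum // => i _.
  by rewrite ler_wiXn2l ?(ltW r0) // -ltnS.
(* For [r > 1] every term of [A] is at least 1, so it suffices to bound the difference by
   [1 / A]. *)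
have AK : K%:R + 1 <= A.
  rewrite natr1 -[K.+1 in X in X <= _]card_ord -sumr_const ler_sum // => i _.
  by rewrite exprn_ege1 // ltW.
have [D0 _] := blocking_denom_bounds R K r r0.
have E := jsq_blocking R K r p r0 pinv.
set A2 := \sum_(k < _) _ => DA.
have A2E : A2 = \sum_(k < K) r ^+ k + r ^+ K * A.
  rewrite /A2; have -> : (2 * K).+1 = (K + K.+1)%N by lia.
  rewrite big_split_ord /= mulr_sumr; congr (_ + _).
  by apply: eq_bigr => i _; rewrite exprD.
have A20 : 0 < A2 by exact: lt_le_trans D0 DA.
apply: (@le_trans _ _ (1 / A)); last first.
  by rewrite !div1r lef_pV2 ?posrE.
have BA : r ^+ (2 * K) / A2 <= B.
  by rewrite ler_pdivrMr // E ler_wpM2l.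
rewrite (@le_trans _ _ (r ^+ K / A - r ^+ (2 * K) / A2)) ?lerB //.
have -> : r ^+ K / A - r ^+ (2 * K) / A2
    = (r ^+ K * A2 - r ^+ (2 * K) * A) / A2 / A.
  by field; rewrite !gt_eqF.
rewrite ler_pM2r ?invr_gt0 // ler_pdivrMr // mul1r.
(* The terms [r^(2K) A] cancel; what remains, [r^K \sum_(k < K) r^k], is at most [r^K A <= A2]. *)
rewrite {1}A2E mulrDr mulrA mul2n -addnn exprD addrK A2E.
rewrite -[X in X <= _]add0r lerD ?sumr_ge0 // => [i _|].
  by rewrite exprn_ge0 ?ltW.
by rewrite ler_pM2l ?exprn_gt0 // /A big_ord_recr /= lerDl exprn_ge0 ?ltW.
Qed.

Lemma sub_nu'_le (R : realType) K (r : R) (p : 'I_K.+1 * 'I_K.+1 -> R) :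
  (0 < K)%N -> 0 < r -> invariant_distribution (jsq_rate K r) p ->
  p (ord_max, ord_max) - nu' K r ord_max <= 2 / K%:R ^+ 2.
Proof.
move=> K0 r0 pinv; set B := p _.
have E := jsq_blocking R K r p r0 pinv.
have [D0 AD _] := blocking_denom_bounds R K r r0.
rewrite /nu' /= ifF; last by lia.
have Asqr i := geometric_sum_sqr_ge R K i r r0.
set D := blocking_denom R K r in E D0 AD.
set A := \sum_(k < _) _ in AD Asqr *.
have A1 : 1 <= A.
  rewrite /A big_ord_recl expr0 lerDl sumr_ge0 // => i _.
  by rewrite exprn_ge0 ?ltW.
have KR : 0 < K%:R :> R by rewrite ltr0n.
(* The term of index 0 is split off: its [1/2] matches the normalization of [nu'], so that
   [2 A - 1 - 2 D = U]. *)
pose U : R := \sum_(i < K.-1) (r / 2) ^+ i.+1.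
have DE : D = A - 2^-1 - 2^-1 * U.
  have T1U : \sum_(i < K) (r / 2) ^+ i = 1 + U.
    by rewrite /U; case: (K) K0 => // m _; rewrite big_ord_recl expr0.
  by rewrite /D /blocking_denom -/A T1U; lra.
have half : \sum_(i < K.-1) (2^-1 : R) ^+ i.+1 <= 1.
  under eq_bigr do rewrite exprS.
  rewrite -mulr_sumr; have := subrX1 (2^-1 : R) K.-1.
  by have : 0 <= (2^-1 : R) ^+ K.-1 by []; lra.
(* Each [K^2 r^(2K+i+1)] is at most [A^2], and the weights [2^(-i-1)] sum to at most 1. *)
have UA : K%:R ^+ 2 * r ^+ (2 * K) * U <= A ^+ 2.
  apply: (@le_trans _ _ (A ^+ 2 * \sum_(i < K.-1) (2^-1 : R) ^+ i.+1)).
    rewrite /U !mulr_sumr ler_sum // => i _.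
    rewrite exprMn mulrA ler_wpM2r //; rewrite -mulrA -exprD Asqr //.
    by have := ltn_ord i; lia.
  by rewrite ler_piMr // exprn_ge0 // (le_trans ler01).
have BE : B = r ^+ (2 * K) / D by rewrite E mulfK ?gt_eqF.
have D1 : 0 < 2 * A - 1 by lra.
have -> : B - 2 * (2 * A - 1)^-1 * r ^+ (2 * K)
    = r ^+ (2 * K) * U / (D * (2 * A - 1)).
  rewrite BE -[U](_ : 2 * A - 1 - 2 * D = U); last by rewrite DE; lra.
  by field; rewrite !gt_eqF.
rewrite ler_pdivrMr ?mulr_gt0 // mulrAC ler_pdivlMr ?exprn_gt0 //.
rewrite mulrC mulrA (le_trans UA) //.
(* Here [D >= A / 2], and [2 A - 1 >= A] because [A >= 1]. *)
have : 2^-1 * A * A <= D * (2 * A - 1) by rewrite ler_pM //; lra.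
by lra.
Qed.

(** * Bounds for the suprema over [rho] *)

Theorem proposition3 (R : realType) (K : nat)
    (pi_ : R -> 'I_K.+1 * 'I_K.+1 -> R) :
  (1 <= K)%N ->
  (forall rho : R, 0 < rho -> invariant_distribution (jsq_rate K rho) (pi_ rho)) ->
  (((K%:R + 2 ^- K - 1) / ((K%:R + 1) * (2 * K%:R + 2 ^- K)))%:E
     <= ereal_sup [set (nu K rho ord_max - pi_ rho (ord_max, ord_max))%:E
                  | rho in [set rho : R | (0 < rho)%R]]
     <= (1 / (K%:R + 1))%:E)%E
  /\
  (((2^-1 - 2 ^- K) / ((2 * K%:R + 2^-1) * (2 * K%:R + 2 ^- K)))%:E
     <= ereal_sup [set (pi_ rho (ord_max, ord_max) - nu' K rho ord_max)%:E
                  | rho in [set rho : R | (0 < rho)%R]]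
     <= (2 / K%:R ^+ 2)%:E)%E.
Proof.
move=> K1 piinv.
have w0 : 0 < 2 ^- K :> R by rewrite invr_gt0 exprn_gt0.
have K0 : 0 <= K%:R :> R by [].
have p1 : pi_ 1 (ord_max, ord_max) = (2 * K%:R + 2 ^- K)^-1.
  have := jsq_blocking R K 1 (pi_ 1) ltr01 (piinv 1 ltr01).
  rewrite expr1n blocking_denom_at1 => E.
  by apply: (mulIf (_ : 2 * K%:R + 2 ^- K != 0)); rewrite -?E ?mulVf ?gt_eqF; lra.
split; apply/andP; split.
- apply: ereal_sup_ubound; exists 1; first exact: ltr01.
  congr (_%:E); rewrite /nu p1 expr1n; under eq_bigr do rewrite expr1n.
  rewrite sumr_const card_ord -natr1.
  by field; apply/andP; split; rewrite gt_eqF //; lra.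
- apply: ge_ereal_sup => _ [r r0 <-]; rewrite lee_fin.
  exact: nu_sub_le (piinv r r0).
- apply: ereal_sup_ubound; exists 1; first exact: ltr01.
  (* As [K >= 1], the state [2K] is not 0, and [nu'(2K)] at [r = 1] is
     [2 / (4K + 1) = 1 / (2K + 1/2)]. *)
  congr (_%:E); rewrite /nu' p1 /= ifF; last by lia.
  rewrite expr1n; under eq_bigr do rewrite expr1n.
  rewrite sumr_const card_ord -[(2 * K).+1%:R]natr1 natrM.
  by field; rewrite !gt_eqF //; lra.
- apply: ge_ereal_sup => _ [r r0 <-]; rewrite lee_fin.
  exact: sub_nu'_le (piinv r r0).
Qed.
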